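(* Let $Q$ be a topological groupoid on a topological space $X$, and let $\mathcal{U}=\{U_i : i\in I\}$ be an open cover of $X$ which is path compatible with $Q$, so that the local subgroupoid $c_1(Q,\mathcal{U})$ of $Q$ is defined. Suppose that $\mathcal{U}$ is path local for $c_1(Q,\mathcal{U})$. Then the atlas $\{(U_i, C_1(Q|U_i)) : i\in I\}$ of $c_1(Q,\mathcal{U})$ is globally adapted, i.e. $glob(c_1(Q,\mathcal{U}))$ is the subgroupoid of $Q$ generated by all the $C_1(Q|U_i)$, $i\in I$.
   Context: A groupoid $Q$ on $X$ has object set $X$, source $\alpha$ and target $\beta$; $gh$ is defined iff $\beta(g)=\alpha(h)$. A topological groupoid on $X$ has topologies on its set of arrows and on its object space $X$ making all structure maps continuous; subgroupoids get the subspace topology. A subgroupoid is wide if it has all objects. For $U\subseteq X$, $Q|U$ is the full subgroupoid on $U$ (and similarly $H|W$ for a subgroupoid $H$). The star $\mathrm{St}_Q x$ is the set of arrows with source $x$. The star identity path component $C_1(Q)$ is the set of $g\in Q$ such that, with $x=\alpha(g)$, there is a path in $\mathrm{St}_Q x$ joining $g$ to $1_x$; it is a wide subgroupoid of $Q$. Local subgroupoids: for $x\in X$, consider pairs $(U,H)$ with $U$ an open neighbourhood of $x$ and $H$ a wide subgroupoid of $Q|U$. Pairs $(U,H)$, $(V,K)$ have the same germ at $x$, $[U,H]_x=[V,K]_x$, iff $H|W=K|W$ for some open $W$ with $x\in W\subseteq U\cap V$. A local subgroupoid $s$ of $Q$ assigns to each $x\in X$ a germ $s(x)$ at $x$ such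 that each point of $X$ has an open neighbourhood $U$ and a wide subgroupoid $H$ of $Q|U$ with $s(y)=[U,H]_y$ for all $y\in U$ (equivalently, a continuous global section of the sheaf associated to the presheaf $U\mapsto\{\text{wide subgroupoids of } Q|U\}$). An atlas for $s$ is a family $\{(U_i,H_i)\}$ with $\{U_i\}$ an open cover of $X$, $H_i$ a wide subgroupoid of $Q|U_i$, and $s(x)=[U_i,H_i]_x$ whenever $x\in U_i$. Order: $[U',H']_x\leq[U,H]_x$ iff there is an open $W$ with $x\in W\subseteq U\cap U'$ and $H'|W$ a subgroupoid of $H|W$; $s\leq t$ iff $s(x)\leq t(x)$ for all $x$. For a wide subgroupoid $H$ of $Q$, $loc(H)(x)=[X,H]_x$. For a local subgroupoid $s$ of $Q$, $glob(s)$ is the intersection of all wide subgroupoids $H$ of $Q$ with $s\leq loc(H)$. An atlas $\{(U_i,H_i)\}$ for $s$ is globally adapted if $glob(s)$ equals the subgroupoid of $Q$ generated by all the $H_i$. The cover $\mathcal U$ is path compatible with $Q$ if for all $i,j\in I$ and $x\in U_i\cap U_j$ there is an open $W$ with $x\in W\subseteq U_i\cap U_j$ and $C_1(Q|U_i)|W=C_1(Q|U_j)|W$; then $c_1(Q,\mathcal U)$ is the local subgroupoid with value $[U_i,C_1(Q|U_i)]_x$ at $x\in U_i$. The cover $\mathcal U$ is path local for $c_1(Q,\mathcal U)$ if for every open $U\subseteq X$, all $i,j\in I$ and $x\in U_i\cap U_j\cap U$ there is an open $W$ with $x\in W\subseteq U_i\cap U_j\cap U$ and $C_1(Q|U_i)|W=C_1(Q|(U_j\cap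 U))|W$. *)

(* Defs.v *)
From HB Require Import structures.
From mathcomp Require Import all_boot all_order all_algebra.
From mathcomp Require Import ring lra.
From mathcomp Require Import all_classical all_reals topology normedtype.
Import Order.TTheory GRing.Theory Num.Theory numFieldNormedType.Exports.

Set Implicit Arguments.
Unset Strict Implicit.
Unset Printing Implicit Defensive.

Local Open Scope classical_set_scope.
Local Open Scope ring_scope.

(* A topological groupoid on X.  The product [gmul g h] is only meaningful when
   [tgt g = src h]; it is written in diagrammatic order (first g, then h), and
   its values on other pairs are unconstrained. *)
Record topGroupoid (X : topologicalType) := TopGroupoid {
  arrow :> topologicalType;
  src : arrow -> X;
  tgt : arrow -> X;
  gid : X -> arrow;
  ginv : arrow -> arrow;
  gmul : arrow -> arrow -> arrow;
  src_gid : forall x, src (gid x) = x;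
  tgt_gid : forall x, tgt (gid x) = x;
  src_ginv : forall g, src (ginv g) = tgt g;
  tgt_ginv : forall g, tgt (ginv g) = src g;
  src_gmul : forall g h, tgt g = src h -> src (gmul g h) = src g;
  tgt_gmul : forall g h, tgt g = src h -> tgt (gmul g h) = tgt h;
  gmulA : forall g h k, tgt g = src h -> tgt h = src k ->
    gmul g (gmul h k) = gmul (gmul g h) k;
  gmul1g : forall g, gmul (gid (src g)) g = g;
  gmulg1 : forall g, gmul g (gid (tgt g)) = g;
  gmulgV : forall g, gmul g (ginv g) = gid (src g);
  gmulVg : forall g, gmul (ginv g) g = gid (tgt g);
  src_continuous : continuous src;
  tgt_continuous : continuous tgt;
  gid_continuous : continuous gid;
  ginv_continuous : continuous ginv;
  gmul_continuous :
    {within [set p : arrow * arrow | tgt p.1 = src p.2],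
      continuous (fun p : arrow * arrow => gmul p.1 p.2)}
}.

Section Subgroupoids.
Context {X : topologicalType} (Q : topGroupoid X).
Implicit Types (H K : set Q) (U V W : set X).

(* A subgroupoid is given by its set of arrows; its objects are the points
   whose identity arrow it contains. *)
Record subgroupoid H : Prop := Subgroupoid {
  sub_gid_src : forall g, H g -> H (gid Q (src g));
  sub_gid_tgt : forall g, H g -> H (gid Q (tgt g));
  sub_ginv : forall g, H g -> H (ginv g);
  sub_gmul : forall g h, H g -> H h -> tgt g = src h -> H (gmul g h)
}.

Definition objects H : set X := [set x | H (gid Q x)].

Definition generated (F : set Q) : set Q := smallest subgroupoid F.

Definition full U : set Q := [set g | U (src g) /\ U (tgt g)].

Definition restr H W : set Q := H `&` full W.

(* H is a wide subgroupoid of the full subgroupoid Q|U; that H lies in Q|U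
   follows, see [wide_sub_full]. *)
Definition wide_subgroupoid U H : Prop := subgroupoid H /\ objects H = U.

Lemma wide_sub_full U H : wide_subgroupoid U H -> H `<=` full U.
Proof.
move=> [sH <-] g Hg; split; [exact: sub_gid_src Hg|exact: sub_gid_tgt Hg].
Qed.

Lemma full_wide U : wide_subgroupoid U (full U).
Proof.
split; last first.
  by apply/seteqP; split=> x; rewrite /objects /full /= src_gid tgt_gid => // -[].
split=> [g [sg tg]|g [sg tg]|g [sg tg]|g h [sg tg] [sh th] gh].
- by split; rewrite /= ?src_gid ?tgt_gid.
- by split; rewrite /= ?src_gid ?tgt_gid.
- by split; rewrite /= ?src_ginv ?tgt_ginv.
- by split; rewrite /= ?src_gmul ?tgt_gmul.
Qed.

Definition star H (x : X) : set Q := H `&` [set g | src g = x].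

End Subgroupoids.

Arguments full {X} Q U _.

Section Paths.
Context (R : realType) {T : topologicalType}.
Implicit Types (S : set T) (a b c : T).

Definition joined S a b : Prop :=
  exists f : R -> T, [/\ {within `[0, 1]%classic, continuous f}, f 0 = a, f 1 = b &
    forall t : R, t \in `[0, 1]%R -> S (f t)].

Lemma joined_refl S a : S a -> joined S a a.
Proof.
move=> Sa; exists (fun=> a); split=> //.
by apply: continuous_subspaceT => t; exact: cvg_cst.
Qed.

End Paths.

Lemma within_comp_continuous (T U V : topologicalType) (A : set T) (D : set U)
    (f : T -> U) (g : U -> V) :
  {within A, continuous f} -> (forall x, A x -> D (f x)) ->
  {within D, continuous g} -> {within A, continuous (g \o f)}.
Proof.
move=> /subspace_continuousP cf fD /subspace_continuousP cg.
apply/subspace_continuousP => x Ax N /(cg _ (fD _ Ax)) /= gN.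
have := cf x Ax _ gN; rewrite /= /within /= /nbhs /=.
by rewrite !near_simpl => H; near=> t => At; apply: (near H t) => //; exact: fD.
Unshelve. all: by end_near. Qed.

Lemma joined_map (R : realType) (T U : topologicalType) (S : set T)
    (S' : set U) (g : T -> U) a b :
  {within S, continuous g} -> (forall x, S x -> S' (g x)) ->
  joined R S a b -> joined R S' (g a) (g b).
Proof.
move=> cg gS [f [cf f0 f1 fS]]; exists (g \o f); split => /=.
- by apply: within_comp_continuous cf _ cg => t /fS.
- by rewrite f0.
- by rewrite f1.
- by move=> t /fS/gS.
Qed.

Lemma joined_sym (R : realType) (T : topologicalType) (S : set T) a b :
  joined R S a b -> joined R S b a.
Proof.
move=> [f [cf f0 f1 fS]]; exists (f \o (fun t => 1 - t)).
have I t : t \in `[0, 1]%R -> 1 - t \in `[0, 1 : R]%R.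
  by rewrite !in_itv /= => /andP[? ?]; apply/andP; split; lra.
split => /=; rewrite ?subr0 ?subrr //; last by move=> t /I/fS.
apply: within_comp_continuous cf; last by move=> t /I.
apply: continuous_subspaceT => t; apply: cvgB; [exact: cvg_cst|exact: cvg_id].
Qed.

Lemma joined_trans (R : realType) (T : topologicalType) (S : set T) a b c :
  joined R S a b -> joined R S b c -> joined R S a c.
Proof.
move=> [f [cf f0 f1 fS]] [g [cg g0 g1 gS]].
pose k t : T := if t <= 2^-1 then f (2 * t) else g (2 * t - 1).
have If t : t \in `[0, 2^-1]%R -> 2 * t \in `[0, 1 : R]%R.
  by rewrite !in_itv /= => /andP[? ?]; apply/andP; split; lra.
have Ig t : t \in `[2^-1, 1]%R -> 2 * t - 1 \in `[0, 1 : R]%R.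
  by rewrite !in_itv /= => /andP[? ?]; apply/andP; split; lra.
have kf t : t \in `[0, 2^-1]%R -> k t = f (2 * t).
  by rewrite in_itv /= /k => /andP[_ ->].
have kg t : t \in `[2^-1, 1]%R -> k t = g (2 * t - 1).
  rewrite in_itv /= /k => /andP[t1 _]; case: ifPn => // t2.
  have -> : t = 2^-1 by apply/eqP; rewrite eq_le t2 t1.
  by have -> : 2 * 2^-1 = 1 :> R; [lra | rewrite subrr f1 g0].
have U t : t \in `[0, 1 : R]%R -> t \in `[0, 2^-1]%R \/ t \in `[2^-1, 1]%R.
  rewrite !in_itv /= => /andP[t0 t1].
  by have [?|?] := leP t 2^-1; [left|right]; apply/andP; split => //; exact: ltW.
have AB : `[0, 1 : R]%classic `<=` `[0, 2^-1]%classic `|` `[2^-1, 1]%classic.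
  by move=> t /= It; exact: U.
exists k; split.
- apply: (continuous_subspaceW AB).
  apply: withinU_continuous; [exact: interval_closed|exact: interval_closed| |].
  + apply: (@subspace_eq_continuous _ _ _ (f \o (fun t => 2 * t))) => [t|].
      by rewrite inE /from_subspace /= => /kf ->.
    apply: within_comp_continuous cf; last by move=> t /If.
    by apply: continuous_subspaceT => t; apply: cvgM; [exact: cvg_cst|exact: cvg_id].
  + apply: (@subspace_eq_continuous _ _ _ (g \o (fun t => 2 * t - 1))) => [t|].
      by rewrite inE /from_subspace /= => /kg ->.
    apply: within_comp_continuous cg; last by move=> t /Ig.
    apply: continuous_subspaceT => t; apply: cvgB; last exact: cvg_cst.
    by apply: cvgM; [exact: cvg_cst|exact: cvg_id].
- by rewrite kf ?mulr0 // in_itv /=; apply/andP; split; lra.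
- rewrite kg; last by rewrite in_itv /=; apply/andP; split; lra.
  by have -> : 2 * 1 - 1 = 1 :> R by lra.
- by move=> t /U[] I; rewrite ?(kf _ I) ?(kg _ I); [exact/fS/If|exact/gS/Ig].
Qed.

Section StarComponent.
Context (R : realType) {X : topologicalType} (Q : topGroupoid X).
Implicit Types (H : set Q) (U : set X).

(* The star identity path component of the subgroupoid H of Q; stars of H carry
   the topology induced from Q. *)
Definition C1 H : set Q :=
  [set g | H g /\ joined R (star H (src g)) g (gid Q (src g))].

Lemma C1_wide U H : wide_subgroupoid U H -> wide_subgroupoid U (C1 H).
Proof.
move=> [sH <-].
have gid_C1 x : H (gid Q x) -> C1 H (gid Q x).
  move=> Hx; split=> //; rewrite src_gid; apply: joined_refl.
  by split=> //=; rewrite src_gid.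
have transl g a b : H g -> joined R (star H (tgt g)) a b ->
    joined R (star H (src g)) (gmul g a) (gmul g b).
  move=> Hg; apply: joined_map => [|h [Hh /= hg]]; last first.
    by split; [exact: (sub_gmul sH)|rewrite /= src_gmul].
  apply: (@within_comp_continuous _ _ _ _ _ (fun h : Q => (g, h)) _ _ _
    (gmul_continuous (t := Q))).
    apply: continuous_subspaceT => h.
    by apply: cvg_pair => /=; [exact: cvg_cst|exact: cvg_id].
  by move=> h [_ /= ->].
split; last by apply/seteqP; split=> x => [[]|] //; exact: gid_C1.
split.
- by move=> g [Hg _]; apply/gid_C1/(sub_gid_src sH).
- by move=> g [Hg _]; apply/gid_C1/(sub_gid_tgt sH).
- move=> g [Hg jg]; split; first exact: (sub_ginv sH).
  have := transl (ginv g) _ _ (sub_ginv sH Hg).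
  rewrite tgt_ginv => /(_ _ _ jg); rewrite gmulVg src_ginv => /joined_sym.
  by rewrite -[in gid Q (src g)]tgt_ginv gmulg1.
- move=> g h [Hg jg] [Hh jh] gh; split; first exact: (sub_gmul sH).
  rewrite src_gmul //; apply: joined_trans jg.
  by have := transl g _ _ Hg; rewrite gh => /(_ _ _ jh); rewrite -gh gmulg1.
Qed.

End StarComponent.

Section LocalSubgroupoids.
Context {X : topologicalType} (Q : topGroupoid X).
Implicit Types (H K : set Q) (U V W : set X) (x : X).

Definition germ_pair x (p : set X * set Q) : Prop :=
  [/\ open p.1, p.1 x & wide_subgroupoid p.1 p.2].

Definition same_germ x (p q : set X * set Q) : Prop :=
  exists W, [/\ open W, W x, W `<=` p.1 `&` q.1 & restr p.2 W = restr q.2 W].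

(* The germ [U, H]_x, as an equivalence class of pairs. *)
Definition germ x U H : set (set X * set Q) :=
  [set q | germ_pair x q /\ same_germ x (U, H) q].

Record local_subgroupoid := LocalSubgroupoid {
  germ_at :> X -> set (set X * set Q);
  germ_at_local : forall x, exists U H,
    [/\ open U, U x, wide_subgroupoid U H & forall y, U y -> germ_at y = germ y U H]
}.

Definition is_atlas (s : local_subgroupoid) (I : Type) (U : I -> set X)
    (H : I -> set Q) : Prop :=
  [/\ forall i, open (U i), \bigcup_i U i = setT,
      forall i, wide_subgroupoid (U i) (H i) &
      forall i x, U i x -> s x = germ x (U i) (H i)].

(* The order on germs at x, a and b being equivalence classes; by [germ_leE]
   the choice of representatives is irrelevant. *)
Definition germ_le x (a b : set (set X * set Q)) : Prop :=
  exists p q, [/\ a p, b q & exists W, [/\ open W, W x, W `<=` p.1 `&` q.1 &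
    restr p.2 W `<=` restr q.2 W]].

Definition local_le (s t : local_subgroupoid) : Prop :=
  forall x, germ_le x (s x) (t x).

Lemma restr_restr H V W : W `<=` V -> restr (restr H V) W = restr H W.
Proof.
move=> WV; apply/seteqP; split=> [g [[]]|g [Hg [sg tg]]] //.
by split=> //; split=> //; split; exact: WV.
Qed.

Lemma same_germ_sym x p q : same_germ x p q -> same_germ x q p.
Proof. by move=> [W [oW Wx WU e]]; exists W; split=> //; rewrite setIC. Qed.

Lemma same_germ_trans x p q r :
  same_germ x p q -> same_germ x q r -> same_germ x p r.
Proof.
move=> [V [oV Vx VU eV]] [W [oW Wx WU eW]]; exists (V `&` W); split=> //.
- exact: openI.
- by move=> y [/VU[? _] /WU[_ ?]].
- rewrite -(@restr_restr _ V) ?eV; last exact: subIsetl.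
  rewrite restr_restr; last exact: subIsetl.
  rewrite -(@restr_restr _ W) ?eW; last exact: subIsetr.
  by rewrite restr_restr //; exact: subIsetr.
Qed.

Lemma germ_refl x U H : open U -> U x -> wide_subgroupoid U H -> germ x U H (U, H).
Proof. by move=> oU Ux wH; split=> //; exists U; split=> // y. Qed.

Lemma same_germ_eq x U H V K :
  same_germ x (U, H) (V, K) -> germ x U H = germ x V K.
Proof.
move=> e; apply/seteqP; split=> p [wp ep]; split=> //.
- exact: same_germ_trans (same_germ_sym e) ep.
- exact: same_germ_trans e ep.
Qed.

Lemma germ_leE x U H V K :
  germ_pair x (U, H) -> germ_pair x (V, K) ->
  germ_le x (germ x U H) (germ x V K) <->
  exists W, [/\ open W, W x, W `<=` U `&` V & restr H W `<=` restr K W].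
Proof.
move=> [oU Ux wH] [oV Vx wK]; split; last first.
  by move=> ?; exists (U, H), (V, K); split=> //; exact: germ_refl.
move=> [p [q [[_ [W1 [oW1 W1x W1U e1]]] [_ [W2 [oW2 W2x W2U e2]]]
  [W [oW Wx _ le]]]]].
exists (W1 `&` (W2 `&` W)); split=> //; first exact/openI/openI.
  by move=> y [/W1U[? _] [/W2U[? _] _]].
move=> g [Hg [[s1 [s2 s3]] [t1 [t2 t3]]]]; split=> //.
have [pg _] : restr p.2 W1 g by rewrite -e1.
have [qg _] : restr q.2 W g by exact: le.
by have [] : restr K W2 g by rewrite e2.
Qed.

Lemma loc_subproof H : wide_subgroupoid setT H -> forall x, exists U K,
  [/\ open U, U x, wide_subgroupoid U K & forall y, U y -> germ y setT H = germ y U K].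
Proof. by move=> wH x; exists setT, H; split=> //; exact: openT. Qed.

Definition loc H (wH : wide_subgroupoid setT H) : local_subgroupoid :=
  LocalSubgroupoid (loc_subproof wH).

Definition glob (s : local_subgroupoid) : set Q :=
  \bigcap_(H in [set H : set Q | exists wH : wide_subgroupoid setT H,
    local_le s (loc wH)]) H.

Definition globally_adapted (s : local_subgroupoid) (I : Type)
    (U : I -> set X) (H : I -> set Q) : Prop :=
  is_atlas s U H /\ glob s = generated (\bigcup_i H i).

End LocalSubgroupoids.

Section PathComponents.
Context (R : realType) {X : topologicalType} (Q : topGroupoid X).
Context {I : Type} (U : I -> set X).

Definition is_open_cover : Prop :=
  (forall i, open (U i)) /\ \bigcup_i U i = setT.

Definition path_compatible : Prop :=
  forall i j x, (U i `&` U j) x ->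
  exists W, [/\ open W, W x, W `<=` U i `&` U j &
    restr (C1 R (full Q (U i))) W = restr (C1 R (full Q (U j))) W].

Definition path_local : Prop :=
  forall V : set X, open V -> forall i j x, (U i `&` U j `&` V) x ->
  exists W, [/\ open W, W x, W `<=` U i `&` U j `&` V &
    restr (C1 R (full Q (U i))) W = restr (C1 R (full Q (U j `&` V))) W].

Context (Ucover : is_open_cover) (Ucompat : path_compatible).

(* All the germs in this union are equal, see [c1E]. *)
Definition c1_germ (x : X) : set (set X * set Q) :=
  \bigcup_(i in [set i | U i x]) germ x (U i) (C1 R (full Q (U i))).

Lemma c1_germE i x : U i x -> c1_germ x = germ x (U i) (C1 R (full Q (U i))).
Proof.
move=> Uix; apply/seteqP; split=> [p [j /= Ujx]|p ?]; last by exists i.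
by rewrite (@same_germ_eq _ _ x (U j) _ (U i) (C1 R (full Q (U i)))) //; exact: Ucompat.
Qed.

Lemma c1_subproof x : exists V H, [/\ open V, V x, wide_subgroupoid V H &
  forall y, V y -> c1_germ y = germ y V H].
Proof.
have [oU cU] := Ucover; have [i _ Uix] : (\bigcup_i U i) x by rewrite cU.
exists (U i), (C1 R (full Q (U i))); split=> //; last exact: c1_germE.
exact/C1_wide/full_wide.
Qed.

Definition c1 : local_subgroupoid Q := LocalSubgroupoid c1_subproof.

Lemma c1E i x : U i x -> c1 x = germ x (U i) (C1 R (full Q (U i))).
Proof. exact: c1_germE. Qed.

End PathComponents.

(* Main.v *)
Require Import Defs.
From mathcomp Require Import all_boot all_order all_algebra.
From mathcomp Require Import lra.
From mathcomp Require Import all_classical all_reals topology normedtype.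
Import Order.TTheory GRing.Theory Num.Theory numFieldNormedType.Exports.

(** For any local subgroupoid [s] with an atlas [(U i, H i)], the subgroupoid
    generated by the [H i] is wide and lies above [s], hence contains [glob s]
    ([glob_sub_generated]).

    The converse inclusion is special to star identity path components.  Let
    [K] be a wide subgroupoid with [s <= loc K]: around each point of [U i],
    the small arrows of [C1 (Q|U i)] lie in [K].  An arrow [g] of
    [C1 (Q|U i)] comes with a path [f] from [g] to an identity inside one star
    of [Q|U i].  All arrows [f t] are again in [C1 (Q|U i)], as the rest of the
    path shows, hence so are the quotients [(f t)^-1 * f t'].  For [t'] near
    [t] both ends of this quotient are near [tgt (f t)], so it is in [K].
    Hence the condition that [f t] is in [K] is locally constant in [t]; it
    holds at the identity end of the path, so by connectedness of the unit
    interval it holds at [g] ([C1_sub_of_local]). *)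

Set Implicit Arguments.
Unset Strict Implicit.
Unset Printing Implicit Defensive.

Local Open Scope classical_set_scope.
Local Open Scope ring_scope.

Lemma connected_locally_constant (T : topologicalType) (A P : set T) (a b : T) :
  connected A ->
  (forall t, A t -> \forall t' \near t, A t' -> (P t <-> P t')) ->
  A a -> A b -> P a -> P b.
Proof.
move=> cA locP Aa Ab Pa.
suff: A `&` P = A by move=> e; have [] : (A `&` P) b by rewrite e.
apply: cA; first by exists a.
- exists (interior [set t | A t -> P t]); first exact: open_interior.
  apply/seteqP; split=> t [At Pt]; split=> //.
    by apply: filterS (locP t At) => t' e /e[/(_ Pt)].
  exact: (interior_subset Pt).
- exists (~` interior [set t | A t -> ~ P t]).
    exact/open_closedC/open_interior.
  apply/seteqP; split=> t [At Pt]; split=> //.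
    by move=> /interior_subset /(_ At).
  apply: contrapT => nPt; apply: Pt.
  by apply: filterS (locP t At) => t' e /e[_ Pt'] /Pt'.
Qed.

(** Every arrow met by the path is again joined to its endpoint, by the
    remaining part of the path run at constant speed. *)
Lemma joined_tail (R : realType) (T : topologicalType) (S : set T)
    (f : R -> T) (t : R) :
  {within `[0, 1]%classic, continuous f} ->
  (forall u : R, u \in `[0, 1]%R -> S (f u)) ->
  t \in `[0, 1]%R -> joined R S (f t) (f 1).
Proof.
move=> cf fS; rewrite in_itv /= => /andP[t0 t1].
have I (u : R) : u \in `[0, 1]%R -> t + u * (1 - t) \in `[0, 1 : R]%R.
  by rewrite !in_itv /= => /andP[u0 u1]; apply/andP; split; nra.
exists (f \o (fun u => t + u * (1 - t))); split=> /=.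
- apply: within_comp_continuous cf; last by move=> u /I.
  apply: continuous_subspaceT => u.
  apply: cvgD; first exact: cvg_cst.
  by apply: cvgM; [exact: cvg_id|exact: cvg_cst].
- by rewrite mul0r addr0.
- by rewrite mul1r addrC subrK.
- by move=> u /I/fS.
Qed.

Section Groupoid.
Context {X : topologicalType} (Q : topGroupoid X).
Implicit Types (H K : set Q) (U W : set X).

(** The principle behind the theorem: a path in a star is a product of small
    arrows, so a subgroupoid that contains the small arrows of [C1 H] contains
    all of them. *)
Lemma C1_sub_of_local (R : realType) H K :
  subgroupoid H -> subgroupoid K ->
  (forall x, objects H x ->
    exists W, [/\ open W, W x & restr (C1 R H) W `<=` K]) ->
  C1 R H `<=` K.
Proof.
move=> sH sK loc_sub g C1g.
have [sC _] := C1_wide R (conj sH (erefl (objects H))).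
have C1_star h : C1 R H h -> objects H (tgt h).
  by move=> [Hh _]; exact: sub_gid_tgt Hh.
have [Hg [f [cf f0 f1 fS]]] := C1g.
have fC (t : R) : t \in `[0, 1]%R -> C1 R H (f t).
  move=> It; have [Hft /= sft] := fS t It; split=> //.
  by rewrite sft -f1; exact: joined_tail It.
have src_f (t : R) : t \in `[0, 1]%R -> src (f t) = src g by move=> /fS[].
have I0 : (0 : R) \in `[0, 1]%R by rewrite in_itv /= lexx ler01.
have I1 : (1 : R) \in `[0, 1]%R by rewrite in_itv /= lexx ler01.
rewrite -f0.
apply: (@connected_locally_constant R `[0, 1]%classic (fun t => K (f t)) 1 0) => //.
- exact: segment_connected.
- move=> t It.
  have [W [oW Wt WK]] := loc_sub _ (C1_star _ (fC t It)).
  (* Within [W] the quotient of two arrows of the path is a small arrow. *)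
  have quotK u v : u \in `[0, 1]%R -> v \in `[0, 1]%R ->
      W (tgt (f u)) -> W (tgt (f v)) -> K (f u) -> K (f v).
    move=> Iu Iv Wu Wv Ku.
    have uv : tgt (ginv (f u)) = src (f v) by rewrite tgt_ginv !src_f.
    have Kq : K (gmul (ginv (f u)) (f v)).
      apply: WK; split.
        by apply: (sub_gmul sC) => //; [apply: (sub_ginv sC)|]; exact: fC.
      by split; rewrite /= ?src_gmul ?tgt_gmul ?src_ginv.
    have -> : f v = gmul (f u) (gmul (ginv (f u)) (f v)).
      by rewrite gmulA ?src_ginv // gmulgV src_f // -(src_f v) // gmul1g.
    by apply: (sub_gmul sK) => //; rewrite src_gmul ?src_ginv.
  have /subspace_continuousP/(_ t It) cft := cf.
  have : \forall u \near t, `[0, 1]%classic u -> W (tgt (f u)).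
    by apply: (cft (tgt (t := Q) @^-1` W)); apply: tgt_continuous; exact: open_nbhs_nbhs.
  apply: filterS => u Wu Iu; split; apply: quotK => //; exact: Wu.
- rewrite f1; have [W [_ Wx]] := loc_sub _ (sub_gid_src sH Hg).
  apply; split; first exact: sub_gid_src C1g.
  by split; rewrite /= ?src_gid ?tgt_gid.
Qed.

Lemma generated_subgroupoid (F : set Q) : subgroupoid (generated F).
Proof.
split=> [g Gg|g Gg|g Gg|g h Gg Gh gh] K [sK FK].
- by apply: (sub_gid_src sK); exact: Gg.
- by apply: (sub_gid_tgt sK); exact: Gg.
- by apply: (sub_ginv sK); exact: Gg.
- by apply: (sub_gmul sK) => //; [exact: Gg|exact: Gh].
Qed.

Lemma glob_sub_generated (s : local_subgroupoid Q) (I : Type)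
    (U : I -> set X) (H : I -> set Q) :
  is_atlas s U H -> glob s `<=` generated (\bigcup_i H i).
Proof.
move=> [oU cU wH sE].
have HG : \bigcup_i H i `<=` generated (\bigcup_i H i) by exact: sub_gen_smallest.
have cov x : exists i, U i x.
  have [i _ Ux] : (\bigcup_i U i) x by rewrite cU.
  by exists i.
have wG : wide_subgroupoid setT (generated (\bigcup_i H i)).
  split; first exact: generated_subgroupoid.
  apply/seteqP; split=> // x _; have [i Ux] := cov x.
  by apply: HG; exists i => //; have [_ e] := wH i; rewrite -e in Ux.
apply: bigcap_inf; exists wG => x; have [i Ux] := cov x.
have gT : germ_pair x (setT, generated (\bigcup_i H i)).
  by split=> //; exact: openT.
have gU : germ_pair x (U i, H i) by split=> /=.
rewrite (sE _ _ Ux); apply/(germ_leE gU gT).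
exists (U i); split=> // g [Hg Wg]; split=> //.
by apply: HG; exists i.
Qed.

Lemma atlas_le_loc (s : local_subgroupoid Q) (I : Type) (U : I -> set X)
    (H : I -> set Q) K (wK : wide_subgroupoid setT K) i x :
  is_atlas s U H -> local_le s (loc wK) -> U i x ->
  exists W, [/\ open W, W x & restr (H i) W `<=` K].
Proof.
move=> [oU _ wH sE] le Ux.
have gK : germ_pair x (setT, K) by split=> //; exact: openT.
have gU : germ_pair x (U i, H i) by split=> /=.
have := le x; rewrite (sE _ _ Ux) => /(germ_leE gU gK)[W [oW Wx _ sub]].
by exists W; split=> // g /sub[].
Qed.

End Groupoid.

Lemma c1_atlas (R : realType) (X : topologicalType) (Q : topGroupoid X)
    (I : Type) (U : I -> set X)
    (Ucover : is_open_cover U) (Ucompat : path_compatible R Q U) :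
  is_atlas (c1 Ucover Ucompat) U (fun i => C1 R (full Q (U i))).
Proof.
have [oU cU] := Ucover; split=> // [i|i x Ux]; last exact: c1E.
exact/C1_wide/full_wide.
Qed.

Theorem corollary7p9 (R : realType) (X : topologicalType) (Q : topGroupoid X)
    (I : Type) (U : I -> set X)
    (Ucover : is_open_cover U) (Ucompat : path_compatible R Q U) :
  path_local R Q U ->
  globally_adapted (c1 Ucover Ucompat) U (fun i => C1 R (full Q (U i))).
Proof.
move=> _; have atl := c1_atlas Ucover Ucompat; split=> //.
apply/seteqP; split; first exact: glob_sub_generated atl.
move=> g Gg K [wK le]; have [sK _] := wK; apply: Gg; split=> // h [i _].
have [sU eU] := full_wide Q (U i).
apply: C1_sub_of_local => // x; rewrite eU => Ux.
exact: atlas_le_loc atl le Ux.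
Qed.
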